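(* Let $\mathcal{U}\in \mathbb{C}^{I_1\times\cdots\times I_M \times J_1\times\cdots\times J_N }$ and $\mathcal{V}\in \mathbb{C}^{J_1\times\cdots\times J_N \times K_1\times\cdots\times K_L }$. Let $\mathcal{M} \in \mathbb{C}^{I_1\times\cdots\times I_M \times I_1 \times\cdots\times I_M}$ and $\mathcal{N} \in \mathbb{C}^{K_1\times\cdots\times K_L \times K_1 \times\cdots\times K_L}$ be a pair of Hermitian positive definite tensors. Then $$(\mathcal{U} *_N \mathcal{V})_{\mathcal{M},\mathcal{N}}^\dagger =[(\mathcal{U}_{\mathcal{M},\mathcal{I}_N}^\dagger)^* *_N \mathcal{V}]_{\mathcal{M}^{-1},\mathcal{N}}^\dagger *_M (\mathcal{V}_{\mathcal{I}_N,\mathcal{N}}^\dagger *_N \mathcal{U}_{\mathcal{M},\mathcal{I}_N}^\dagger)^* *_L [\mathcal{U} *_N(\mathcal{V}_{\mathcal{I}_N,\mathcal{N}}^\dagger)^*]_{\mathcal{M},\mathcal{N}^{-1}}^\dagger.$$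
   Context: Einstein product: for $\mathcal{A}\in\mathbb{C}^{I_1\times\cdots\times I_M\times J_1\times\cdots\times J_N}$ and $\mathcal{B}\in\mathbb{C}^{J_1\times\cdots\times J_N\times K_1\times\cdots\times K_L}$, $(\mathcal{A}*_N\mathcal{B})_{i_1\ldots i_Mk_1\ldots k_L}=\sum_{j_1,\ldots,j_N}a_{i_1\ldots i_Mj_1\ldots j_N}b_{j_1\ldots j_Nk_1\ldots k_L}$ (the subscript is the number of contracted indices; similarly $*_M,*_L$). The conjugate transpose $\mathcal{A}^*$ has entries $(\mathcal{A}^* )_{j_1\ldots j_Ni_1\ldots i_M}=\overline{a_{i_1\ldots i_Mj_1\ldots j_N}}$. $\mathcal{I}_N$ is the identity tensor of $\mathbb{C}^{J_1\times\cdots\times J_N\times J_1\times\cdots\times J_N}$, with entries $\prod_k\delta_{i_kj_k}$ (and analogously for other index sets); inverses of tensors with the same row and column index sets are taken with respect to the Einstein product. A tensor $\mathcal{P}$ with the same row and column index sets is Hermitian positive definite if $\mathcal{P}=\mathcal{W}*\mathcal{D}*\mathcal{W}^*$ (Einstein products over all the row indices) with $\mathcal{W}$ unitary ($\mathcal{W}*\mathcal{W}^*=\mathcal{W}^**\mathcal{W}$ is the identity tensor) and $\mathcal{D}$ a diagonal tensor with positive diagonal entries. Weighted Moore-Penrose inverse: for $\mathcal{A}\in\mathbb{C}^{I_1\times\cdots\times I_M\times J_1\times\cdots\times J_N}$ and Hermitian positive definite $\mathcal{M}\in\mathbb{C}^{I_1\times\cdots\times I_M\times I_1\times\cdots\times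 I_M}$, $\mathcal{N}\in\mathbb{C}^{J_1\times\cdots\times J_N\times J_1\times\cdots\times J_N}$, $\mathcal{A}^\dagger_{\mathcal{M},\mathcal{N}}$ is the unique $\mathcal{Y}\in\mathbb{C}^{J_1\times\cdots\times J_N\times I_1\times\cdots\times I_M}$ with $\mathcal{A}*_N\mathcal{Y}*_M\mathcal{A}=\mathcal{A}$, $\mathcal{Y}*_M\mathcal{A}*_N\mathcal{Y}=\mathcal{Y}$, $(\mathcal{M}*_M\mathcal{A}*_N\mathcal{Y})^*=\mathcal{M}*_M\mathcal{A}*_N\mathcal{Y}$, $(\mathcal{N}*_N\mathcal{Y}*_M\mathcal{A})^*=\mathcal{N}*_N\mathcal{Y}*_M\mathcal{A}$. The same definition applies with other index sets. *)

(* Defs.v *)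
From mathcomp Require Import all_boot all_order all_algebra.
From mathcomp Require Import classical_sets.

Set Implicit Arguments.
Unset Strict Implicit.
Unset Printing Implicit Defensive.

Import Order.TTheory GRing.Theory Num.Theory.
Local Open Scope ring_scope.

(* Multi-indices (i_1, ..., i_m) with i_k < d k; indices are 0-based. *)
Definition midx (m : nat) (d : 'I_m -> nat) := {dffun forall k : 'I_m, 'I_(d k)}.

(* The entry a_{i_1 ... i_m j_1 ... j_n} of A : tensor C I J is A (i, j), where
   i groups the first m indices (rows) and j the last n indices (columns). *)
Definition tensor (C : Type) (m n : nat) (I : 'I_m -> nat) (J : 'I_n -> nat) :=
  {ffun midx I * midx J -> C}.

Section Tensor.
Variable C : numClosedFieldType.

(* All the indices of J are contracted, so their number is read off the type. *)
Definition einstein m n l (I : 'I_m -> nat) (J : 'I_n -> nat) (K : 'I_l -> nat)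
    (A : tensor C I J) (B : tensor C J K) : tensor C I K :=
  [ffun ik => \sum_(j : midx J) A (ik.1, j) * B (j, ik.2)].

Definition ctrans m n (I : 'I_m -> nat) (J : 'I_n -> nat)
    (A : tensor C I J) : tensor C J I :=
  [ffun ji => (A (ji.2, ji.1))^*].

Definition idt m (I : 'I_m -> nat) : tensor C I I :=
  [ffun ij : midx I * midx I => \prod_(k < m) (ij.1 k == ij.2 k)%:R].

End Tensor.

Notation "A *e B" := (einstein A B)
  (at level 40, left associativity, format "A  *e  B") : ring_scope.
Notation "A ^H" := (ctrans A) (at level 1, left associativity, format "A ^H")
  : ring_scope.

Section Inverses.
Variable C : numClosedFieldType.

Definition is_inverse m (I : 'I_m -> nat) (A B : tensor C I I) : Prop :=
  A *e B = idt C I /\ B *e A = idt C I.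

(* The two-sided inverse is unique when it exists; otherwise the value is 0. *)
Definition tinv m (I : 'I_m -> nat) (A : tensor C I I) : tensor C I I :=
  xget 0 [set B | is_inverse A B].

Definition unitary m (I : 'I_m -> nat) (W : tensor C I I) : Prop :=
  W *e W^H = idt C I /\ W^H *e W = idt C I.

Definition diagonal m (I : 'I_m -> nat) (D : tensor C I I) : Prop :=
  forall i j : midx I, i != j -> D (i, j) = 0.

(* In the partial order of C, 0 < z means that z is real and positive. *)
Definition hpd m (I : 'I_m -> nat) (P : tensor C I I) : Prop :=
  exists W D : tensor C I I,
    [/\ unitary W, diagonal D, forall i : midx I, 0 < D (i, i)
      & P = W *e D *e W^H].

Definition is_wmpinv m n (I : 'I_m -> nat) (J : 'I_n -> nat)
    (M : tensor C I I) (N : tensor C J J) (A : tensor C I J)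
    (Y : tensor C J I) : Prop :=
  [/\ A *e Y *e A = A,
      Y *e A *e Y = Y,
      (M *e A *e Y)^H = M *e A *e Y
    & (N *e Y *e A)^H = N *e Y *e A].

(* For Hermitian positive definite M and N there is exactly one Y with
   is_wmpinv M N A Y, and it is the value; if there is no such Y, the value
   is 0. *)
Definition wmpinv m n (I : 'I_m -> nat) (J : 'I_n -> nat)
    (M : tensor C I I) (N : tensor C J J) (A : tensor C I J) : tensor C J I :=
  xget 0 [set Y | is_wmpinv M N A Y].

End Inverses.

(* Main.v *)
(** For [X := U V], [P := (U^+)^* V], [Q := U (V^+)^*] and [Z := (V^+ U^+)^*],
    the Penrose equations of [U^+] and [V^+] give
      X = Q V^* V,   Z = P (V^+ (V^+)^* ) = (U^+)^* U^+ Q,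
      Z V^* V = P,   U U^* P = X,   U U^* Z = Q.
    Hence [Y := P^+ Z Q^+] satisfies [Y X = P^+ P] and [X Y = Q Q^+], which makes
    it a weighted Moore-Penrose inverse of [X]; such an inverse is unique. *)
Require Import Defs.
From mathcomp Require Import all_boot all_order all_algebra.
From mathcomp Require Import reals complex.
From mathcomp Require Import classical_sets.

Set Implicit Arguments.
Unset Strict Implicit.
Unset Printing Implicit Defensive.

Import Order.TTheory GRing.Theory Num.Theory.
Local Open Scope ring_scope.
Local Open Scope complex_scope.

(** * Weighted Moore-Penrose inverses of complex matrices *)

Section MatrixMP.
Variable C : numClosedFieldType.

Definition hmx m n (A : 'M[C]_(m, n)) : 'M[C]_(n, m) := map_mx Num.conj A^T.

Lemma hmxK m n : cancel (@hmx m n) (@hmx n m).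
Proof. by move=> A; apply/matrixP=> i j; rewrite !mxE conjCK. Qed.

Lemma hmxM m n p (A : 'M_(m, n)) (B : 'M_(n, p)) :
  hmx (A *m B) = hmx B *m hmx A.
Proof. by rewrite /hmx trmx_mul map_mxM. Qed.

Lemma hmx1 n : hmx (1%:M : 'M_n) = 1%:M.
Proof. by rewrite /hmx trmx1 map_mx1. Qed.

Lemma hmxV n (A : 'M_n) : hmx (invmx A) = invmx (hmx A).
Proof. by rewrite /hmx trmx_inv map_invmx. Qed.

Lemma unitmx_hmx n (A : 'M_n) : (hmx A \in unitmx) = (A \in unitmx).
Proof. by rewrite /hmx map_unitmx unitmx_tr. Qed.

(** Each diagonal entry of [A *m hmx A] is the sum of the squared moduli along a row of [A], so it
    vanishes only with the whole row. *)
Lemma mulmx_hmx_eq0 m n (A : 'M_(m, n)) : A *m hmx A = 0 -> A = 0.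
Proof.
move=> AA0; apply/matrixP=> i j; rewrite mxE.
have /eqP : (A *m hmx A) i i = 0 by rewrite AA0 mxE.
rewrite mxE psumr_eq0 => [/allP/(_ j (mem_index_enum _))|k _].
  by rewrite !mxE -normCK sqrf_eq0 normr_eq0 => /eqP.
by rewrite !mxE mul_conjC_ge0.
Qed.

(* Equivalent to Hermitian positive definiteness, by taking square roots of the
    eigenvalues. *)
Definition gram_mx n (P : 'M[C]_n) : Prop :=
  exists2 S : 'M_n, S \in unitmx & P = hmx S *m S.

Lemma gram_mx_unit n (P : 'M_n) : gram_mx P -> P \in unitmx.
Proof. by case=> S uS ->; rewrite unitmx_mul unitmx_hmx uS. Qed.

Lemma gram_mx_herm n (P : 'M_n) : gram_mx P -> hmx P = P.
Proof. by case=> S _ ->; rewrite hmxM hmxK. Qed.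

Lemma gram_mx1 n : gram_mx (1%:M : 'M_n).
Proof. by exists 1%:M; rewrite ?unitmx1// hmx1 mulmx1. Qed.

(** From P = S^* S follows P^-1 = T^* T, where T is the conjugate transpose of S^-1. *)
Lemma gram_mxV n (P : 'M_n) : gram_mx P -> gram_mx (invmx P).
Proof.
case=> S uS defP; exists (hmx (invmx S)).
  by rewrite unitmx_hmx unitmx_inv.
have PT : P *m (invmx S *m hmx (invmx S)) = 1%:M.
  by rewrite defP !mulmxA mulmxK// hmxV mulmxV// unitmx_hmx.
by rewrite hmxK -[LHS]mulmx1 -PT mulKmx// defP unitmx_mul unitmx_hmx uS.
Qed.

(** If v G P G^* = 0 with P = S^* S, then w = v G S^* satisfies w w^* = 0, so w = 0; as S is
    invertible and G row free, v = 0. *)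
Lemma unitmx_row_free_gram r n (G : 'M_(r, n)) (P : 'M_n) :
  row_free G -> gram_mx P -> G *m P *m hmx G \in unitmx.
Proof.
move=> fG [S uS ->]; rewrite -row_free_unit; apply: inj_row_free => v vG0.
have /mulmx_hmx_eq0 : v *m G *m hmx S *m hmx (v *m G *m hmx S) = 0.
  by rewrite !hmxM hmxK !mulmxA in vG0 *; rewrite vG0 mul0mx.
move/(congr1 (mulmx^~ (invmx (hmx S)))); rewrite mul0mx mulmxK ?unitmx_hmx//.
by move=> vG; apply: (row_free_inj fG); rewrite mul0mx.
Qed.

Definition is_wmpmx m n (M : 'M[C]_m) (N : 'M[C]_n) (A : 'M[C]_(m, n))
    (Y : 'M[C]_(n, m)) : Prop :=
  [/\ A *m Y *m A = A, Y *m A *m Y = Y,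
      hmx (M *m A *m Y) = M *m A *m Y & hmx (N *m Y *m A) = N *m Y *m A].

(* For a rank factorization [A = F G], the witness is
   [N^-1 G^* (G N^-1 G^* )^-1 (F^* M F)^-1 F^* M]. *)
Lemma wmpmx_exists m n (M : 'M_m) (N : 'M_n) (A : 'M_(m, n)) :
  gram_mx M -> gram_mx N -> exists Y, is_wmpmx M N A Y.
Proof.
move=> gM gN; have uN := gram_mx_unit gN.
move: (col_base_full A) (row_base_free A) (mulmx_base A).
move: (\rank A) (col_base A) (row_base A) => r F G fF fG defA.
pose a := hmx F *m M *m F; pose b := G *m invmx N *m hmx G.
have ua : a \in unitmx.
  (* Full column rank of [F] makes [hmx F] row free, and [hmx F] plays the role of G. *)
  rewrite /a -{2}[F]hmxK; apply: unitmx_row_free_gram => //.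
  by rewrite /row_free /hmx mxrank_map mxrank_tr.
have ub : b \in unitmx by apply: unitmx_row_free_gram (gram_mxV gN).
have ha : hmx a = a by rewrite /a !hmxM hmxK (gram_mx_herm gM) mulmxA.
have hb : hmx b = b by rewrite /b !hmxM hmxK hmxV (gram_mx_herm gN) mulmxA.
pose Y := invmx N *m hmx G *m invmx b *m invmx a *m hmx F *m M.
(* In [A *m Y] the factor [b] cancels against its inverse, and in [Y *m A] the factor [a] does. What
   remains becomes visibly Hermitian after multiplication by [M], respectively [N]. *)
have AY : A *m Y = F *m invmx a *m hmx F *m M.
  rewrite -defA /Y !mulmxA -(mulmxA (F *m G)) -(mulmxA F) (mulmxA G) -/b.
  by rewrite mulmxK.
have YA : Y *m A = invmx N *m hmx G *m invmx b *m G.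
  rewrite -defA /Y !mulmxA -(mulmxA _ M F) -(mulmxA _ (hmx F)) (mulmxA (hmx F)).
  by rewrite -/a mulmxKV.
exists Y; split.
- rewrite AY -{1}defA !mulmxA -(mulmxA _ M F) -(mulmxA _ (hmx F)).
  by rewrite (mulmxA (hmx F)) -/a mulmxKV.
- rewrite YA /Y !mulmxA -(mulmxA _ G) -(mulmxA _ (G *m _)) -/b.
  by rewrite mulmxKV.
- rewrite -mulmxA AY !hmxM hmxK hmxV ha (gram_mx_herm gM).
  by rewrite !mulmxA.
- rewrite -mulmxA YA !mulmxA mulmxV// mul1mx !hmxM hmxK hmxV hb.
  by rewrite mulmxA.
Qed.

(** [E] and [F] are self-adjoint for the form given by [M], and taking adjoints reverses
    products. *)
Lemma hmx_mul_weighted n (M E F : 'M_n) : M \in unitmx -> hmx M = M ->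
  hmx (M *m E) = M *m E -> hmx (M *m F) = M *m F ->
  hmx (M *m (E *m F)) = M *m (F *m E).
Proof.
move=> uM hM hE hF.
have -> : M *m (E *m F) = M *m E *m invmx M *m (M *m F).
  by rewrite !mulmxA mulmxKV.
by rewrite hmxM hF hmxM hE hmxV hM !mulmxA mulmxKV.
Qed.

(** The projectors A Y1 and A Y2 are self-adjoint for M and absorb each other: A Y2 A Y1 = A Y1 and
    A Y1 A Y2 = A Y2. Taking adjoints identifies them; likewise Y1 A = Y2 A for N. Then Y1 = Y1 A Y1
    = Y2 A Y2 = Y2. *)
Lemma wmpmx_unique m n (M : 'M_m) (N : 'M_n) (A : 'M_(m, n)) Y1 Y2 :
  gram_mx M -> gram_mx N -> is_wmpmx M N A Y1 -> is_wmpmx M N A Y2 -> Y1 = Y2.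
Proof.
move=> gM gN [AYA1 YAY1 hAY1 hYA1] [AYA2 YAY2 hAY2 hYA2].
have [uM uN] := (gram_mx_unit gM, gram_mx_unit gN).
rewrite -!mulmxA in hAY1 hYA1 hAY2 hYA2.
have eAY : A *m Y1 = A *m Y2.
  apply: (can_inj (mulKmx uM)).
  have := hmx_mul_weighted uM (gram_mx_herm gM) hAY2 hAY1.
  by rewrite !(mulmxA (A *m _)) AYA1 AYA2 hAY1.
have eYA : Y1 *m A = Y2 *m A.
  apply: (can_inj (mulKmx uN)).
  have := hmx_mul_weighted uN (gram_mx_herm gN) hYA1 hYA2.
  by rewrite -!mulmxA (mulmxA A) AYA2 (mulmxA A) AYA1 hYA1.
by rewrite -YAY1 eYA -mulmxA eAY mulmxA.
Qed.

Lemma wmpmx_mul m n p (M M' : 'M_m) (N N' : 'M_p)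
    (U : 'M_(m, n)) (V : 'M_(n, p)) Ui Vi Pi Qi :
  is_wmpmx M 1%:M U Ui -> is_wmpmx 1%:M N V Vi ->
  is_wmpmx M' N (hmx Ui *m V) Pi -> is_wmpmx M N' (U *m hmx Vi) Qi ->
  is_wmpmx M N (U *m V) (Pi *m hmx (Vi *m Ui) *m Qi).
Proof.
move=> [UUU UiUUi _]; rewrite !mul1mx => hUiU.
move=> [VVV ViVVi]; rewrite !mul1mx => hVVi _.
set P := hmx Ui *m V; set Q := U *m hmx Vi.
move=> [PPP PiPPi _ hPiP] [QQQ QiQQi hQQi _].
set X := U *m V; set Z := hmx (Vi *m Ui).
have ZE : Z = hmx Ui *m hmx Vi by rewrite /Z hmxM.
have VE : hmx Vi *m hmx V = V *m Vi by rewrite -hmxM.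
have UE : hmx U *m hmx Ui = Ui *m U by rewrite -hmxM.
have XQ : Q *m (hmx V *m V) = X.
  by rewrite /Q /X !mulmxA -(mulmxA U) VE -!mulmxA (mulmxA V) VVV.
have ZP : P *m (Vi *m hmx Vi) = Z.
  by rewrite ZE /P !mulmxA -(mulmxA _ V) -VE -mulmxA -!hmxM mulmxA ViVVi.
have ZQ : hmx Ui *m Ui *m Q = Z.
  by rewrite ZE /Q !mulmxA -(mulmxA _ Ui) -UE -!hmxM UiUUi.
have ZV : Z *m (hmx V *m V) = P.
  by rewrite ZE /P !mulmxA -(mulmxA _ (hmx Vi)) VE -!mulmxA (mulmxA V) VVV.
have UP : U *m hmx U *m P = X.
  by rewrite /P /X !mulmxA -(mulmxA U) UE !mulmxA UUU.
have UZ : U *m hmx U *m Z = Q.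
  by rewrite ZE /Q !mulmxA -(mulmxA U) UE !mulmxA UUU.
clearbody P Q X Z.
(* [Z] is a right multiple of [P] and a left multiple of [Q], so the projectors P P^+ and Q^+ Q fix
   it. *)
have PZ : P *m Pi *m Z = Z by rewrite -ZP mulmxA PPP.
have ZQQ : Z *m Qi *m Q = Z by rewrite -ZQ -!mulmxA (mulmxA Q) QQQ.
set Y := Pi *m Z *m Qi.
have YX : Y *m X = Pi *m P.
  by rewrite /Y -XQ -!mulmxA (mulmxA Qi) (mulmxA Z) (mulmxA Z) ZQQ ZV.
have XY : X *m Y = Q *m Qi.
  by rewrite /Y -UP !mulmxA -(mulmxA _ P) -(mulmxA _ (P *m _)) PZ UZ.
(* Self-adjointness for [M] is inherited from [Q *m Qi], and for [N] from [Pi *m P]. *)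
split.
- by rewrite XY -XQ mulmxA QQQ.
- by rewrite YX /Y !mulmxA PiPPi.
- by rewrite -mulmxA XY mulmxA.
- by rewrite -mulmxA YX mulmxA.
Qed.

End MatrixMP.

(** * Flattening tensors into matrices *)

Section Transfer.
Variable C : numClosedFieldType.

(** Rows and columns follow the enumeration of the multi-indices, so that the Einstein product
    becomes the matrix product. *)
Definition mx_of_tensor m n (I : 'I_m -> nat) (J : 'I_n -> nat)
    (A : tensor C I J) : 'M[C]_(#|midx I|, #|midx J|) :=
  \matrix_(i, j) A (enum_val i, enum_val j).

Definition tensor_of_mx m n (I : 'I_m -> nat) (J : 'I_n -> nat)
    (A : 'M[C]_(#|midx I|, #|midx J|)) : tensor C I J :=
  [ffun ij => A (enum_rank ij.1) (enum_rank ij.2)].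

Local Notation mx := (@mx_of_tensor _ _ _ _).

Lemma mx_of_tensorK m n (I : 'I_m -> nat) (J : 'I_n -> nat) :
  cancel (@mx_of_tensor _ _ I J) (@tensor_of_mx _ _ I J).
Proof. by move=> A; apply/ffunP=> -[i j]; rewrite ffunE mxE /= !enum_rankK. Qed.

Lemma tensor_of_mxK m n (I : 'I_m -> nat) (J : 'I_n -> nat) :
  cancel (@tensor_of_mx _ _ I J) (@mx_of_tensor _ _ I J).
Proof. by move=> A; apply/matrixP=> i j; rewrite !mxE !ffunE /= !enum_valK. Qed.

Lemma mx_of_tensor_inj m n (I : 'I_m -> nat) (J : 'I_n -> nat) :
  injective (@mx_of_tensor _ _ I J).
Proof. exact: can_inj (@mx_of_tensorK _ _ I J). Qed.

Lemma mx_einstein m n l (I : 'I_m -> nat) (J : 'I_n -> nat) (K : 'I_l -> nat)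
    (A : tensor C I J) (B : tensor C J K) :
  mx (A *e B) = mx A *m mx B.
Proof.
apply/matrixP=> i j; rewrite !mxE ffunE /= big_enum_val /=.
by apply: eq_bigr => k _; rewrite !mxE.
Qed.

Lemma mx_ctrans m n (I : 'I_m -> nat) (J : 'I_n -> nat) (A : tensor C I J) :
  mx A^H = hmx (mx A).
Proof. by apply/matrixP=> i j; rewrite !mxE ffunE. Qed.

Lemma idtE m (I : 'I_m -> nat) (i j : midx I) : idt C I (i, j) = (i == j)%:R.
Proof.
rewrite ffunE /=; have [->|neq_ij] := eqVneq i j.
  by apply: big1 => k _; rewrite eqxx.
have /existsP[k neq_k] : [exists k, i k != j k].
  apply: contraR neq_ij; rewrite negb_exists => /forallP eq_ij.
  by apply/eqP/ffunP => k; apply/eqP; rewrite -[_ == _]negbK.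
by rewrite (bigD1 k)//= (negPf neq_k) mul0r.
Qed.

Lemma mx_idt m (I : 'I_m -> nat) : mx (idt C I) = 1%:M.
Proof.
by apply/matrixP=> i j; rewrite !mxE idtE (inj_eq enum_val_inj).
Qed.

(** For P = W D W^* the factor is S = D^(1/2) W^*, where D^(1/2) is real because the diagonal of D
    is positive. *)
Lemma gram_mx_hpd m (I : 'I_m -> nat) (P : tensor C I I) :
  hpd P -> gram_mx (mx P).
Proof.
case=> W [D [[WW' W'W] diagD D_gt0 ->]].
pose s := diag_mx (\row_i sqrtC (D (enum_val i, enum_val i)) : 'rV_#|midx I|).
have hs : hmx s = s.
  rewrite /hmx tr_diag_mx map_diag_mx; congr diag_mx; apply/rowP=> i.
  by rewrite !mxE; apply: conj_Creal; rewrite ger0_real// sqrtC_ge0 ltW.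
have ss : s *m s = mx D.
  rewrite mulmx_diag; apply/matrixP=> i j; rewrite !mxE.
  have [->|neq_ij] := eqVneq i j; first by rewrite mulr1n -expr2 sqrtCK.
  by rewrite mulr0n diagD// (inj_eq enum_val_inj).
have uW : hmx (mx W) \in unitmx.
  have := congr1 mx WW'.
  by rewrite mx_einstein mx_idt mx_ctrans => /mulmx1_unit[].
exists (s *m hmx (mx W)).
  rewrite unitmx_mul uW andbT unitmxE det_diag unitfE prodf_seq_neq0.
  by apply/allP=> i _ /=; rewrite !mxE sqrtC_eq0 gt_eqF.
by rewrite !mx_einstein mx_ctrans hmxM hmxK hs !mulmxA -(mulmxA _ s s) ss.
Qed.

Lemma is_wmpinv_mx m n (I : 'I_m -> nat) (J : 'I_n -> nat)
    (M : tensor C I I) (N : tensor C J J) (A : tensor C I J)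
    (Y : tensor C J I) :
  is_wmpinv M N A Y <-> is_wmpmx (mx M) (mx N) (mx A) (mx Y).
Proof.
rewrite /is_wmpmx -!mx_einstein -!mx_ctrans.
by split=> -[]; [move=> -> -> -> -> | do 4!move=> /mx_of_tensor_inj ?].
Qed.

(** Existence for matrices, carried back to tensors, ensures that [xget] does not return its default
    0. *)
Lemma wmpinvP m n (I : 'I_m -> nat) (J : 'I_n -> nat)
    (M : tensor C I I) (N : tensor C J J) (A : tensor C I J) :
  gram_mx (mx M) -> gram_mx (mx N) ->
  is_wmpmx (mx M) (mx N) (mx A) (mx (wmpinv M N A)).
Proof.
move=> gM gN; apply/is_wmpinv_mx; have [Y YP] := wmpmx_exists (mx A) gM gN.
apply: (@xgetPex _ 0 [set Y | is_wmpinv M N A Y]); exists (tensor_of_mx Y).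
by apply/is_wmpinv_mx; rewrite tensor_of_mxK.
Qed.

Lemma mx_tinv m (I : 'I_m -> nat) (P : tensor C I I) :
  mx P \in unitmx -> mx (tinv P) = invmx (mx P).
Proof.
move=> uP; have [PP' _] : is_inverse P (tinv P).
  apply: (@xgetPex _ 0 [set B | is_inverse P B]).
  exists (tensor_of_mx (invmx (mx P))).
  by split; apply: mx_of_tensor_inj;
    rewrite mx_einstein mx_idt tensor_of_mxK ?mulmxV ?mulVmx.
by rewrite -[LHS](mulKmx uP) -mx_einstein PP' mx_idt mulmx1.
Qed.

End Transfer.

Theorem theorem5 (R : realType) (m n l : nat)
    (I : 'I_m -> nat) (J : 'I_n -> nat) (K : 'I_l -> nat)
    (U : tensor R[i] I J) (V : tensor R[i] J K)
    (M : tensor R[i] I I) (N : tensor R[i] K K)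
    (hM : hpd M) (hN : hpd N) :
  wmpinv M N (U *e V) =
    wmpinv (tinv M) N ((wmpinv M (idt _ J) U)^H *e V)
    *e (wmpinv (idt _ J) N V *e wmpinv M (idt _ J) U)^H
    *e wmpinv M (tinv N) (U *e (wmpinv (idt _ J) N V)^H).
Proof.
have gM := gram_mx_hpd hM; have gN := gram_mx_hpd hN.
(* The inverse weights are again Gram matrices, so all the weighted inverses in the formula
   exist. *)
have gMV : gram_mx (mx_of_tensor (tinv M)).
  by rewrite mx_tinv ?gram_mx_unit//; exact: gram_mxV.
have gNV : gram_mx (mx_of_tensor (tinv N)).
  by rewrite mx_tinv ?gram_mx_unit//; exact: gram_mxV.
have g1 : gram_mx (mx_of_tensor (idt R[i] J)).
  by rewrite mx_idt; exact: gram_mx1.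
have UP := wmpinvP U gM g1; have VP := wmpinvP V g1 gN.
have PP := wmpinvP ((wmpinv M (idt _ J) U)^H *e V) gMV gN.
have QP := wmpinvP (U *e (wmpinv (idt _ J) N V)^H) gM gNV.
rewrite mx_idt in UP VP.
rewrite mx_einstein mx_ctrans in PP; rewrite mx_einstein mx_ctrans in QP.
(* By uniqueness, it suffices that the right-hand side satisfies the four equations for U V. *)
apply: mx_of_tensor_inj; apply: wmpmx_unique gM gN (wmpinvP _ gM gN) _.
rewrite !(mx_einstein, mx_ctrans).
exact: wmpmx_mul UP VP PP QP.
Qed.
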